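(* (i) In dimension $n=2$, let $x\in\mathbb R^2$ and assume that the unit vectors $\hat F_1(x)$ and $\hat F_2(x)$ are neither parallel nor orthogonal. Then $(q_1,q_2)$ form an elliptic family at $x$. (ii) In dimension $n\ge 2$, let $\hat F_1(x)$ and $\hat F_2(x)$ be unit vectors with two different directions (i.e. $\hat F_1(x)\ne\pm\hat F_2(x)$) and let $\hat F_3(x)=\alpha\hat F_1(x)+\beta\hat F_2(x)$ with $\alpha,\beta\in\mathbb R$, $\alpha\beta\neq0$, such that $|\hat F_3(x)|=1$. Then $(q_1,q_2,q_3)$ form an elliptic family at $x$. (iii) In dimension $n\ge 3$, a family $(q_1,q_2)$ is never elliptic at a given point $x$, whatever the choice of unit vectors $\hat F_1(x),\hat F_2(x)$.
   Context: For unit vectors $\hat F_j(x)\in\mathbb R^n$, define the quadratic forms $q_j(x,\xi)=2(\hat F_j(x)\cdot\xi)^2-|\xi|^2$, $\xi\in\mathbb R^n$. A family $\{q_j\}$ is elliptic at $x$ if ($q_j(x,\xi)=0$ for all $j$ in the family) implies $\xi=0$. *)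

(* Defs.v *)
From mathcomp Require Import all_boot all_order all_algebra.
From mathcomp Require Import reals.

Set Implicit Arguments.
Unset Strict Implicit.
Unset Printing Implicit Defensive.

Import Order.TTheory GRing.Theory Num.Theory.

Local Open Scope ring_scope.

Section Ellipticity.
Variables (R : realType) (n : nat).
Implicit Types (u v x xi : 'rV[R]_n) (F : 'rV[R]_n -> 'rV[R]_n).

Definition dot u v : R := \sum_(i < n) u 0 i * v 0 i.

(* The Euclidean norm; MathComp-Analysis puts the sup norm on 'rV[R]_n. *)
Definition enorm u : R := Num.sqrt (dot u u).

Definition unit_vector u : Prop := enorm u = 1.

Definition parallel_vectors u v : Prop :=
  exists c : R, u = c *: v \/ v = c *: u.

Definition orthogonal_vectors u v : Prop := dot u v = 0.

Definition qform F x xi : R := 2 * dot (F x) xi ^+ 2 - enorm xi ^+ 2.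

Definition elliptic_at (J : Type) (q : J -> 'rV[R]_n -> 'rV[R]_n -> R) x : Prop :=
  forall xi, (forall j : J, q j x xi = 0) -> xi = 0.

End Ellipticity.

(* Main.v *)
Require Import Defs.
From mathcomp Require Import all_boot all_order all_algebra.
From mathcomp Require Import reals.
From mathcomp Require Import ring lra.

Set Implicit Arguments.
Unset Strict Implicit.

Import Order.TTheory GRing.Theory Num.Theory.

Local Open Scope ring_scope.

(** A common zero [xi] of q_1 and q_2 satisfies
    [dot u xi ^+ 2 = dot v xi ^+ 2 = dot xi xi / 2], where [u] and [v] are the
    unit vectors F_1(x) and F_2(x).  Hence [dot v xi = e * dot u xi] for a
    sign [e]; write [a = dot u xi] and [c = dot u v].  Ellipticity means that
    [a] is forced to be 0.

    In the plane the three vectors [u], [v], [xi] are dependent, so their Gram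
    determinant vanishes ([gram_det_plane]).  Substituting the values above it
    becomes [2 * a ^+ 2 * c * (e - c) = 0] up to sign, so that [a <> 0] would
    give [c = 0] (orthogonal vectors) or [c = e] (parallel vectors, by the
    equality case of Cauchy-Schwarz, [unit_dot_sign]).

    With the third vector [alpha *: u + beta *: v], its form vanishing at [xi]
    with [a <> 0] says [(alpha + e * beta) ^+ 2 = 1], while its norm being 1
    says [alpha ^+ 2 + beta ^+ 2 + 2 * alpha * beta * c = 1].  Comparing, again
    [c = e], so [u = e *: v], which is excluded.

    From dimension 3 on there is a [w <> 0] orthogonal to [u] and [v].  With
    the sign [e] now chosen so that [e * dot u v >= 0], the vector [u + e *: v]
    makes equal angles of at most 45 degrees with the lines of [u] and [v], and
    tilting it towards [w] brings both angles to exactly 45 degrees, that is,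
    to a common zero of the two forms. *)

Section Dot.
Variables (R : realType) (n : nat).
Implicit Types (u v w xi : 'rV[R]_n) (F : 'rV[R]_n -> 'rV[R]_n).

Lemma dotC u v : dot u v = dot v u.
Proof. by apply: eq_bigr => i _; rewrite mulrC. Qed.

Lemma dotDl u v w : dot (u + v) w = dot u w + dot v w.
Proof. by rewrite -big_split; apply: eq_bigr => i _; rewrite mxE mulrDl. Qed.

Lemma dotZl a u v : dot (a *: u) v = a * dot u v.
Proof. by rewrite /dot mulr_sumr; apply: eq_bigr => i _; rewrite mxE mulrA. Qed.

Lemma dotDr u v w : dot u (v + w) = dot u v + dot u w.
Proof. by rewrite !(dotC u) dotDl. Qed.

Lemma dotZr a u v : dot u (a *: v) = a * dot u v.
Proof. by rewrite !(dotC u) dotZl. Qed.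

Definition dotE := (dotDl, dotDr, dotZl, dotZr).

Lemma dot0r u : dot u 0 = 0.
Proof. by rewrite -(scale0r (0 : 'rV[R]_n)) dotZr mul0r. Qed.

Lemma dot_ge0 u : 0 <= dot u u.
Proof. by apply: sumr_ge0 => i _; rewrite -expr2 sqr_ge0. Qed.

Lemma dot_eq0 u : dot u u = 0 -> u = 0.
Proof.
move=> /psumr_eq0P h; apply/rowP => i; rewrite mxE.
have /eqP : u 0 i * u 0 i = 0 by apply: h => // j _; rewrite -expr2 sqr_ge0.
by rewrite mulf_eq0 orbb => /eqP.
Qed.

Lemma unit_dot u : unit_vector u -> dot u u = 1.
Proof. by move=> h; rewrite -(sqr_sqrtr (dot_ge0 u)) -/(enorm u) h expr1n. Qed.

Lemma qformE F x xi : qform F x xi = 2 * dot (F x) xi ^+ 2 - dot xi xi.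
Proof. by rewrite /qform sqr_sqrtr ?dot_ge0. Qed.

(** Equality case of Cauchy-Schwarz: [dot (u - e *: v) (u - e *: v)] is
    [2 - 2 * e ^+ 2 = 0]. *)
Lemma unit_dot_sign u v (e : R) :
  unit_vector u -> unit_vector v -> e ^+ 2 = 1 -> dot u v = e -> u = e *: v.
Proof.
move=> /unit_dot uu /unit_dot vv e2 uv.
suff /eqP : u + (- e) *: v = 0 by rewrite scaleNr subr_eq0 => /eqP.
apply: dot_eq0; rewrite !dotE (dotC v u) uu vv uv.
by ring: e2.
Qed.

(** Both coordinates [dot u xi] and [dot v xi] of a common zero are
    [enorm xi / sqrt 2] in absolute value, hence equal up to a sign, and they
    can vanish only if [xi] does. *)
Lemma common_zero u v xi :
  2 * dot u xi ^+ 2 - dot xi xi = 0 -> 2 * dot v xi ^+ 2 - dot xi xi = 0 ->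
  xi = 0 \/ exists e : R,
    [/\ e ^+ 2 = 1, dot u xi != 0, dot v xi = e * dot u xi
      & dot xi xi = 2 * dot u xi ^+ 2].
Proof.
move=> hu hv; have xx : dot xi xi = 2 * dot u xi ^+ 2 by lra.
case: (eqVneq (dot u xi) 0) => [a0 | a0].
  by left; apply: dot_eq0; rewrite xx a0 expr0n mulr0.
right; have /eqP : dot v xi ^+ 2 = dot u xi ^+ 2 by lra.
rewrite eqf_sqr => /orP[] /eqP h.
- by exists 1; rewrite expr1n mul1r.
- by exists (-1); rewrite sqrrN expr1n mulN1r.
Qed.

(** Two equations in more than two unknowns. *)
Lemma exists_orthogonal u v : (3 <= n)%N ->
  exists2 w : 'rV[R]_n, w != 0 & dot u w = 0 /\ dot v w = 0.
Proof.
move=> n3; pose A : 'M[R]_(n, 1 + 1) := (col_mx u v)^T.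
have : kermx A != 0.
  rewrite -mxrank_eq0 mxrank_ker -lt0n subn_gt0.
  exact: leq_ltn_trans (rank_leq_col A) n3.
case/rowV0Pn => w /sub_kermxP wA w0; exists w => //.
have dotM z : dot z w = (w *m z^T) 0 0.
  by rewrite mxE; apply: eq_bigr => i _; rewrite mxE mulrC.
move: wA; rewrite /A tr_col_mx mul_mx_row => /eqP.
by rewrite row_mx_eq0 => /andP[/eqP wu /eqP wv]; rewrite !dotM wu wv mxE.
Qed.

End Dot.

(** Expansion of the Gram determinant of [u], [v], [xi], which vanishes because
    three vectors of the plane are dependent. *)
Lemma gram_det_plane (R : realType) (u v xi : 'rV[R]_2) :
  unit_vector u -> unit_vector v ->
  dot xi xi * (1 - dot u v ^+ 2) =
  dot u xi ^+ 2 + dot v xi ^+ 2 - 2 * dot u v * dot u xi * dot v xi.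
Proof.
move=> /unit_dot uu /unit_dot vv.
transitivity (dot xi xi * (dot u u * dot v v - dot u v ^+ 2)).
  by rewrite uu vv mulr1.
transitivity (dot v v * dot u xi ^+ 2 + dot u u * dot v xi ^+ 2
              - 2 * dot u v * dot u xi * dot v xi); last first.
  by rewrite uu vv !mul1r.
by rewrite /dot !big_ord_recl !big_ord0; ring.
Qed.

Lemma elliptic_plane (R : realType) (u v xi : 'rV[R]_2) :
  unit_vector u -> unit_vector v ->
  ~ parallel_vectors u v -> ~ orthogonal_vectors u v ->
  2 * dot u xi ^+ 2 - dot xi xi = 0 -> 2 * dot v xi ^+ 2 - dot xi xi = 0 ->
  xi = 0.
Proof.
move=> uu uv npar northo hu hv.
case: (common_zero hu hv) => // -[e [e2 a0 ve xx]].
have := gram_det_plane xi uu uv; rewrite ve xx => gram.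
have /eqP : dot u xi ^+ 2 * (dot u v * (e - dot u v)) = 0.
  have a2 : e ^+ 2 * dot u xi ^+ 2 = dot u xi ^+ 2 by rewrite e2 mul1r.
  by lra.
rewrite !mulf_eq0 (negbTE a0) /= subr_eq0 => /orP[] /eqP h.
  by case: northo.
by case: npar; exists e; left; apply: unit_dot_sign.
Qed.

Lemma elliptic_third (R : realType) (n : nat) (u v xi : 'rV[R]_n)
    (alpha beta : R) :
  unit_vector u -> unit_vector v -> u <> v -> u <> - v ->
  alpha * beta <> 0 -> unit_vector (alpha *: u + beta *: v) ->
  2 * dot u xi ^+ 2 - dot xi xi = 0 -> 2 * dot v xi ^+ 2 - dot xi xi = 0 ->
  2 * dot (alpha *: u + beta *: v) xi ^+ 2 - dot xi xi = 0 ->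
  xi = 0.
Proof.
move=> uu uv nuv nuNv /eqP ab0 /unit_dot uw hu hv hw.
case: (common_zero hu hv) => // -[e [e2 a0 ve xx]].
have sq1 : (alpha + e * beta) ^+ 2 = 1.
  apply: (mulIf (x := dot u xi ^+ 2)); first by rewrite sqrf_eq0.
  by move: hw; rewrite !dotE ve xx; lra.
have /eqP : alpha * beta * (dot u v - e) = 0.
  have b2 : e ^+ 2 * beta ^+ 2 = beta ^+ 2 by rewrite e2 mul1r.
  by move: uw; rewrite !dotE (dotC v u) !unit_dot //; lra.
rewrite mulf_eq0 (negbTE ab0) /= subr_eq0 => /eqP uve.
have ueq := unit_dot_sign uu uv e2 uve.
move/eqP: e2; rewrite sqrf_eq1 => /orP[] /eqP e1.
- by case: nuv; rewrite ueq e1 scale1r.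
- by case: nuNv; rewrite ueq e1 scaleN1r.
Qed.

Lemma exists_common_zero (R : realType) (n : nat) (u v : 'rV[R]_n) :
  (3 <= n)%N -> unit_vector u -> unit_vector v ->
  exists2 xi : 'rV[R]_n, xi <> 0 &
    2 * dot u xi ^+ 2 - dot xi xi = 0 /\ 2 * dot v xi ^+ 2 - dot xi xi = 0.
Proof.
move=> n3 /unit_dot uu /unit_dot vv.
have [w w0 [uw vw]] := exists_orthogonal u v n3.
have ww0 : dot w w != 0 by apply: contra w0 => /eqP/dot_eq0 ->.
have [e [c [e2 c0 uve]]] :
    exists e c : R, [/\ e ^+ 2 = 1, 0 <= c & dot u v = e * c].
  case: (leP 0 (dot u v)) => uv0.
  - by exists 1, (dot u v); rewrite expr1n mul1r.
  - by exists (-1), (- dot u v); rewrite sqrrN expr1n mulrNN mul1r oppr_ge0 ltW.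
(* For [s = u + e *: v], its products with [u] and [v] are [1 + c] up to
   sign and [dot s s = 2 * (1 + c)], so the component [t *: w] has to
   contribute [2 * (1 + c) ^+ 2 - 2 * (1 + c) = 2 * c * (1 + c)]. *)
pose t := Num.sqrt (2 * c * (1 + c) / dot w w).
have t2 : t ^+ 2 * dot w w = 2 * c * (1 + c).
  rewrite sqr_sqrtr ?divfK // divr_ge0 ?dot_ge0 // !mulr_ge0 //.
  by rewrite addr_ge0.
pose xi := u + e *: v + t *: w.
have uxi : dot u xi = 1 + c by rewrite /xi !dotE uu uw uve; ring: e2.
have vxi : dot v xi = e * (1 + c).
  by rewrite /xi !dotE (dotC v u) vv vw uve; ring.
have xx : dot xi xi = 2 * (1 + c) ^+ 2.
  rewrite {1}/xi !dotDl !dotZl uxi vxi (dotC w) {1}/xi !dotDl !dotZl uw vw.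
  have -> : t * (0 + e * 0 + t * dot w w) = t ^+ 2 * dot w w by ring.
  by rewrite t2 mulrA -expr2 e2; ring.
exists xi; first by (move=> xi0; move: uxi; rewrite xi0 dot0r => uxi; lra).
by rewrite uxi vxi xx exprMn e2 mul1r subrr.
Qed.

Theorem proposition2p3 (R : realType) :
  (* (i) *)
  (forall (F1 F2 : 'rV[R]_2 -> 'rV[R]_2) (x : 'rV[R]_2),
      unit_vector (F1 x) -> unit_vector (F2 x) ->
      ~ parallel_vectors (F1 x) (F2 x) -> ~ orthogonal_vectors (F1 x) (F2 x) ->
      elliptic_at (tnth [tuple qform F1; qform F2]) x)
  /\
  (* (ii) *)
  (forall (n : nat) (F1 F2 F3 : 'rV[R]_n -> 'rV[R]_n) (x : 'rV[R]_n)
      (alpha beta : R),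
      (2 <= n)%N ->
      unit_vector (F1 x) -> unit_vector (F2 x) ->
      F1 x <> F2 x -> F1 x <> - F2 x ->
      F3 x = alpha *: F1 x + beta *: F2 x ->
      alpha * beta <> 0 ->
      unit_vector (F3 x) ->
      elliptic_at (tnth [tuple qform F1; qform F2; qform F3]) x)
  /\
  (* (iii) *)
  (forall (n : nat) (F1 F2 : 'rV[R]_n -> 'rV[R]_n) (x : 'rV[R]_n),
      (3 <= n)%N ->
      unit_vector (F1 x) -> unit_vector (F2 x) ->
      ~ elliptic_at (tnth [tuple qform F1; qform F2]) x).
Proof.
split; [|split].
- move=> F1 F2 x u1 u2 npar northo xi q0.
  have := q0 ord0; have := q0 (lift ord0 ord0).
  rewrite !(tnth_nth (qform F1)) /= !qformE => h2 h1.
  exact: elliptic_plane u1 u2 npar northo h1 h2.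
- move=> n F1 F2 F3 x alpha beta _ u1 u2 ne neN F3x ab0 u3 xi q0.
  have := q0 ord0; have := q0 (lift ord0 ord0).
  have := q0 (lift ord0 (lift ord0 ord0)).
  rewrite !(tnth_nth (qform F1)) /= !qformE => h3 h2 h1.
  rewrite F3x in u3 h3.
  exact: elliptic_third u1 u2 ne neN ab0 u3 h1 h2 h3.
- move=> n F1 F2 x n3 u1 u2 ell.
  have [xi xi0 [h1 h2]] := exists_common_zero n3 u1 u2.
  apply: xi0; apply: ell => j; rewrite (tnth_nth (qform F1)).
  by case: j => -[|[|//]] /= _; rewrite qformE.
Qed.
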